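(* Let $d\ge1$, $0\le n\le m\le N$ be integers and $\rho\in(0,1)^d$ with $|\rho|<1$. For $\alpha\in\mathbb Z_m^{d+1}$ and $x\in\mathbb Z_N^{d+1}$, $$\mathsf L_{\alpha,n}(x;\rho,N)=\frac{(-1)^m(-N)_m(-m)_n}{n!}\sum_{k=0}^n\frac{(-n)_k}{(-m)_k(-N)_k}\,\mathcal F_k(\alpha,x;\rho).$$
   Context: Notation: $(a)_n=a(a+1)\cdots(a+n-1)$, $(a)_0=1$; for vectors, $|y|$ is the sum of the components, $\alpha!=\prod_i\alpha_i!$, $y^\alpha=\prod_iy_i^{\alpha_i}$, $(y)_\alpha=\prod_i(y_i)_{\alpha_i}$. $\mathbb Z_N^{d+1}=\{\alpha\in\mathbb N_0^{d+1}:|\alpha|=N\}$, $\boldsymbol\rho=(\rho,1-|\rho|)\in\mathbb R^{d+1}$. Inner product: $\langle f,g\rangle_{\mathsf K_{\rho,N}}=N!\sum_{x\in\mathbb Z_N^{d+1}}f(x)g(x)\frac{\boldsymbol\rho^x}{x!}$. $\Pi_n^d$ is the space of polynomials of total degree at most $n$ in $x_1,\dots,x_d$ ($\Pi_{-1}^d=\{0\}$), regarded as functions on $\mathbb Z_N^{d+1}$ (where $x_{d+1}=N-x_1-\cdots-x_d$); polynomials in $x_1,\dots,x_{d+1}$ are regarded as functions on $\mathbb Z_N^{d+1}$ in the same way. For $0\le n\le N$, $\mathcal V_n^d(\mathsf K_{\rho,N})$ is the space of $p\in\Pi_n^d$ orthogonal to $\Pi_{n-1}^d$. Let $\mathrm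 m_\alpha(x)=(-1)^{|\alpha|}(-x)_\alpha$, and for $n\le|\alpha|\le N$ let $\mathsf L_{\alpha,n}(\cdot;\rho,N)=\boldsymbol\rho^{-\alpha}\,\mathrm{proj}_{\mathcal V_n^d(\mathsf K_{\rho,N})}\mathrm m_\alpha$, with $\mathrm{proj}$ the orthogonal projection of $\Pi_N^d$ onto $\mathcal V_n^d(\mathsf K_{\rho,N})$. Further, $\mathcal F_0(x,y;\rho)=1$ and $\mathcal F_k(x,y;\rho)=\sum_{\gamma\in\mathbb N_0^{d+1},|\gamma|=k}\frac{(-x)_\gamma(-y)_\gamma}{\gamma!\,\boldsymbol\rho^\gamma}$ for $k\ge1$. *)

(* Defs.v *)
From HB Require Import structures.
From mathcomp Require Import all_boot all_order all_algebra.
From mathcomp Require Import mpoly.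

Set Implicit Arguments.
Unset Strict Implicit.
Unset Printing Implicit Defensive.

Import Order.TTheory GRing.Theory Num.Theory.
Local Open Scope ring_scope.

(* The multi-indices in N_0^n of length exactly N; the bound N.+1 on the degree
   only serves to make the type finite. *)
Record simplex (n N : nat) := Simplex {
  simplex_mnm :> 'X_{1..n < N.+1}; _ : mdeg simplex_mnm == N }.
HB.instance Definition _ n N := [isSub for @simplex_mnm n N].
HB.instance Definition _ n N := [Finite of simplex n N by <:].

Section MultiIndex.
Variable R : realFieldType.
Implicit Types (n : nat) (a : R).

Definition poch a k : R := \prod_(i < k) (a + i%:R).

Definition mpoch n (y : 'I_n -> R) (g : 'X_{1..n}) : R :=
  \prod_i poch (y i) (g i).

Definition mpow n (y : 'I_n -> R) (g : 'X_{1..n}) : R := \prod_i y i ^+ g i.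

Definition mfact n (g : 'X_{1..n}) : nat := (\prod_i (g i)`!)%N.

Definition pt n (g : 'X_{1..n}) : 'I_n -> R := fun i => (g i)%:R.

(* (rho, 1 - |rho|), the last coordinate having index ord_max. *)
Definition brho d (rho : 'I_d -> R) (i : 'I_d.+1) : R :=
  if unlift ord_max i is Some j then rho j else 1 - \sum_j rho j.

Definition calF d (rho : 'I_d -> R) k (x y : 'I_d.+1 -> R) : R :=
  if k == 0%N then 1 else
  \sum_(g : simplex d.+1 k)
    mpoch (fun i => - x i) g * mpoch (fun i => - y i) g
      / ((mfact g)%:R * mpow (brho rho) g).

End MultiIndex.

Section Krawtchouk.
Variables (R : realFieldType) (d : nat) (rho : 'I_d -> R) (N : nat).
(* R^o is R seen as a vector space over itself. *)
Local Notation U := {ffun simplex d.+1 N -> R^o}.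

Definition kip (f g : U) : R :=
  N`!%:R * \sum_(x : simplex d.+1 N)
             f x * g x * (mpow (brho rho) x / (mfact x)%:R).

Lemma kip_bilinear :
  bilinear_for (GRing.Scale.Law.clone _ _ *%R _)
    (GRing.Scale.Law.clone _ _ *%R _) kip.
Proof.
split=> [g|f] a u v /=; rewrite /kip mulrCA -mulrDr; congr (_ * _);
  rewrite mulr_sumr -big_split /=; apply: eq_bigr => x _;
  rewrite !ffunE -[_ *: _]/(a * _).
  by rewrite 2!mulrDl !mulrA.
by rewrite mulrDr mulrDl !mulrA (mulrC (f x) a).
Qed.

HB.instance Definition _ := bilinear_isBilinear.Build R U U R _ _ kip
  kip_bilinear.

Lemma kip_sym f g : kip f g = (-1) ^+ false * idfun (kip g f).
Proof.
rewrite expr0 mul1r /= /kip; congr (_ * _); apply: eq_bigr => x _.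
by rewrite [f x * _]mulrC.
Qed.

HB.instance Definition _ :=
  @isHermitianSesquilinear.Build R U false idfun kip kip_sym.

(* A polynomial in x_1, ..., x_d as a function on the simplex. *)
Definition polyfun (p : {mpoly R[d]}) : U :=
  [ffun x : simplex d.+1 N => p.@[fun i => pt R x (lift ord_max i)]].

(* Polynomial functions of total degree < k (see polysP): Pi_n^d is polys n.+1
   and Pi_(n-1)^d is polys n, so that Pi_(-1)^d = 0. *)
Definition polys (k : nat) : {vspace U} :=
  <<[seq polyfun 'X_[m] | m : 'X_{1..d < k}]>>%VS.

Lemma polysP k (f : U) :
  reflect (exists2 p : {mpoly R[d]}, (msize p <= k)%N & f = polyfun p)
          (f \in polys k).
Proof.
have pfD p q : polyfun (p + q) = polyfun p + polyfun q.
  by apply/ffunP=> x; rewrite !ffunE mevalD.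
have pfZ a p : polyfun (a *: p) = a *: polyfun p.
  by apply/ffunP=> x; rewrite !ffunE mevalZ.
have pf0 : polyfun 0 = 0 by apply/ffunP=> x; rewrite !ffunE meval0.
have mem_mon (m : 'X_{1..d}) : (mdeg m < k)%N -> polyfun 'X_[m] \in polys k.
  move=> mk; apply: memv_span; apply/mapP.
  by exists (BMultinom mk); rewrite ?mem_enum.
apply: (iffP idP) => [|[p pk ->]].
  move/coord_span=> ->.
  apply: (big_ind (fun g => exists2 p : {mpoly R[d]},
    (msize p <= k)%N & g = polyfun p)).
  - by exists 0; rewrite ?msize0 ?pf0.
  - move=> _ _ [p pk ->] [q qk ->]; exists (p + q); rewrite ?pfD //.
    by rewrite (leq_trans (msizeD_le _ _)) // geq_max pk.
  - move=> i _.
    set c := coord _ _ _.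
    set mons := (X in X`_i); have: mons`_i \in mons.
      by apply: mem_nth; rewrite size_image.
    case/mapP=> m _ ->; exists (c *: 'X_[m]); last by rewrite pfZ.
    by rewrite (leq_trans (msizeZ_le _ _)) // msizeX bmdeg.
rewrite [p in polyfun p](mpolyE p).
have: {in msupp p, forall m, (mdeg m < k)%N}.
  by move=> m /msize_mdeg_lt h; apply: leq_trans pk.
elim: (msupp p) => [|m s IH] h; first by rewrite big_nil pf0 mem0v.
rewrite big_cons pfD pfZ rpredD ?rpredZ ?mem_mon //.
  by apply: h; rewrite mem_head.
by apply: IH => m' sm'; apply: h; rewrite in_cons sm' orbT.
Qed.

Definition korth (W : {vspace U}) : {vspace U} :=
  @orthov R false idfun U kip W.

Lemma mem_korthP (W : {vspace U}) (u : U) :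
  reflect {in W, forall v, kip u v = 0} (u \in korth W).
Proof. exact: (@mem_orthovP R false idfun U kip). Qed.

Definition calV (n : nat) : {vspace U} :=
  (polys n.+1 :&: korth (polys n))%VS.

(* Every function on the simplex lies in Pi_N^d, so the whole function space is
   taken as the domain; see orthprojP. *)
Definition orthproj (W : {vspace U}) (f : U) : U :=
  daddv_pi W (korth W) f.

Lemma orthprojP (rho_gt0 : forall i, 0 < rho i) (rho_lt1 : \sum_i rho i < 1)
    (W : {vspace U}) (f : U) :
  orthproj W f \in W /\ {in W, forall g, kip (f - orthproj W f) g = 0}.
Proof.
have kip_def (u : U) : kip u u = 0 -> u = 0.
  move=> u0; apply/ffunP=> x; rewrite ffunE.
  have pow_gt0 (y : simplex d.+1 N) : 0 < mpow (brho rho) y / (mfact y)%:R.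
    rewrite divr_gt0 ?ltr0n ?prodn_gt0 //; last by move=> i; rewrite fact_gt0.
    apply: prodr_gt0 => i _; apply: exprn_gt0; rewrite /brho.
    by case: (unlift _ _) => [j|] //; rewrite subr_gt0.
  move/eqP: u0; rewrite mulf_eq0 pnatr_eq0 -leqn0 leqNgt fact_gt0 /=.
  rewrite psumr_eq0 => [/allP/(_ x (mem_index_enum _))|y _]; last first.
    apply: mulr_ge0; last exact: ltW (pow_gt0 y).
    exact: (@sqr_ge0 R (u y)).
  by rewrite mulf_eq0 (gt_eqF (pow_gt0 x)) orbF mulf_eq0 orbb => /eqP.
have WW0 : (W :&: korth W = 0)%VS.
  apply/eqP; rewrite -subv0; apply/subvP => u /memv_capP[uW /mem_korthP uo].
  by rewrite memv0 (kip_def u (uo u uW)).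
pose h (u : U) : 'rV[R]_(\dim W) := \row_i kip u (vbasis W)`_i.
have h_lin : linear h.
  by move=> a u v; apply/rowP=> i; rewrite !mxE (linearPl kip).
pose hL := GRing.isLinear.Build _ _ _ _ h h_lin.
pose hl : {linear U -> 'rV[R]_(\dim W)} := HB.pack h hL.
have kerE : lker (linfun hl) = korth W.
  apply/vspaceP=> u; apply/idP/mem_korthP => [|uo].
    rewrite memv_ker lfunE => /eqP/rowP h0 v /coord_vbasis->.
    rewrite linear_sumr big1 // => i _; rewrite linearZr_LR /=.
    by have := h0 i; rewrite !mxE => ->; rewrite mulr0.
  rewrite memv_ker lfunE; apply/eqP/rowP=> i; rewrite !mxE.
  by apply: uo; apply: vbasis_mem; rewrite mem_nth ?size_tuple.
have WWf : (W + korth W = fullv)%VS.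
  apply/eqP; rewrite eqEdim subvf /= dimv_disjoint_sum //.
  rewrite -(limg_ker_dim (linfun hl) fullv) capfv kerE addnC leq_add2r.
  by rewrite (leq_trans (dimvS (subvf _))) // dimvf /dim /= mul1n.
split=> [|g gW]; first exact: memv_pi.
have fs : f \in (W + korth W)%VS by rewrite WWf memvf.
rewrite /orthproj -[X in kip (X - _)](daddv_pi_add WW0 fs) addrC addKr.
by move: g gW; apply/mem_korthP; apply: memv_pi.
Qed.

Definition mfall (a : 'X_{1..d.+1}) : U :=
  [ffun x : simplex d.+1 N =>
     (-1) ^+ mdeg a * mpoch (fun i => - pt R x i) a].

Definition sfL (a : 'X_{1..d.+1}) (n : nat) : U :=
  (mpow (brho rho) a)^-1 *: orthproj (calV n) (mfall a).

End Krawtchouk.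

(* Main.v *)
(* Write a for alpha and r for the extended weights, put
     f_k(a,x) = k! F_k(a,x) / (m^_k N^_k),   Q_n = sum_k (-1)^k C(n,k) f_k,
   so that the right-hand side is (-1)^n C(m,n) N^_m Q_n.  Contiguity relations
   for F_k, valid for arbitrary real vectors a with |a| = m + 1, give
     (m+1) (N+1) Q_(n+1)(a,x)
       = sum_(i,j) a_i x_j (1 - [i = j] / r_i) Q_n(a - e_i, x - e_j),
   the right-hand Q_n having parameters m and N.  The adjoint of
   f |-> x_j f(x - e_j) is (N+1) r_j times the shift by e_j, so <Q_(n+1), g>
   becomes a combination of the <Q_n(a - e_i,.), g(. + e_j) - g(. + e_i)>; since
   these differences lower the degree, Q_n is orthogonal to polynomials of degree < n by induction.
   Finally binomial inversion turns f_m = m_alpha / (N^_m rho^alpha) into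
   sum_n (-1)^n C(m,n) Q_n, which is the decomposition of m_alpha along the
   spaces V_n. *)
Require Import Defs.
From mathcomp Require Import all_boot all_order all_algebra.
From mathcomp Require Import mpoly.
From mathcomp Require Import ring.
Set Implicit Arguments.
Unset Strict Implicit.
Unset Printing Implicit Defensive.

Import Order.TTheory GRing.Theory Num.Theory.
Local Open Scope ring_scope.

(** * Alternating binomial sums *)

Section AlternatingSums.
Variable R : comNzRingType.
Implicit Types f : nat -> R.

(** The binomial transform, that is (-1)^n times the n-th forward difference of f at 0. *)
Definition altsum n f : R := \sum_(k < n.+1) (-1) ^+ k * 'C(n, k)%:R * f k.

Lemma eq_altsum n f1 f2 :
  (forall k, (k <= n)%N -> f1 k = f2 k) -> altsum n f1 = altsum n f2.
Proof. by move=> e; apply: eq_bigr => k _; rewrite e // -ltnS. Qed.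

Lemma altsumB n f1 f2 :
  altsum n (fun k => f1 k - f2 k) = altsum n f1 - altsum n f2.
Proof.
by rewrite /altsum -sumrB; apply: eq_bigr => k _; rewrite mulrBr.
Qed.

Lemma altsumS n f : altsum n.+1 f = altsum n f - altsum n (f \o succn).
Proof.
rewrite /altsum big_ord_recl /= [X in _ = X - _]big_ord_recl !bin0 -addrA.
congr (_ + _).
under eq_bigr => k _.
  rewrite /bump /= add1n binS natrD mulrDr mulrDl; over.
rewrite big_split /=; congr (_ + _).
  by rewrite big_ord_recr /= bin_small // mulr0 mul0r addr0.
rewrite -sumrN; apply: eq_bigr => k _.
by rewrite exprS mulN1r !mulNr.
Qed.

(** Binomial inversion. By [altsumS], consecutive transforms of f differ by a transform of
    [f \o succn], to which the induction hypothesis applies. *)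
Lemma altsumK n f : altsum n (altsum^~ f) = f n.
Proof.
elim: n f => [|n IH] f; first by rewrite /altsum !big_ord1 !expr0 bin0 !mul1r.
rewrite altsumS -altsumB -[RHS](IH (f \o succn)); apply: eq_altsum => k _ /=.
by rewrite altsumS opprB addrC subrK.
Qed.

Lemma altsum_mull n c f : altsum n (fun k => c * f k) = c * altsum n f.
Proof. by rewrite mulr_sumr; apply: eq_bigr => k _; ring. Qed.

Lemma altsum_sum n (I : Type) (r : seq I) (P : pred I) (F : I -> nat -> R) :
  altsum n (fun k => \sum_(i <- r | P i) F i k)
  = \sum_(i <- r | P i) altsum n (F i).
Proof. by rewrite exchange_big; apply: eq_bigr => k _; rewrite mulr_sumr. Qed.

End AlternatingSums.

(** * Multi-indices *)

Section Simplex.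
Variable n : nat.

Lemma mdeg_simplex N (x : simplex n N) : mdeg x = N.
Proof. by case: x => x /= /eqP. Qed.

Lemma sum_simplex (R : pzSemiRingType) N (x : simplex n N) :
  \sum_i (x i)%:R = N%:R :> R.
Proof. by rewrite -natr_sum -mdegE mdeg_simplex. Qed.

Lemma mksimplex_subproof N (g : 'X_{1..n}) : mdeg g = N -> (mdeg g < N.+1)%N.
Proof. by move->. Qed.

Definition mksimplex N (g : 'X_{1..n}) (e : mdeg g = N) : simplex n N :=
  @Simplex n N (BMultinom (mksimplex_subproof e)) (introT eqP e).

Lemma simplex_inj N (x y : simplex n N) : x = y :> 'X_{1..n} -> x = y.
Proof. by move=> e; do 2!apply: val_inj. Qed.

(** Reindexing by x = y + e_i: the points outside the image of this injection have x_i = 0, where h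
    vanishes. *)
Lemma sum_simplexS (V : nmodType) N i (h : 'X_{1..n} -> V) :
    (forall g : 'X_{1..n}, g i = 0%N -> h g = 0) ->
  \sum_(x : simplex n N.+1) h x = \sum_(y : simplex n N) h (y + U_(i))%MM.
Proof.
move=> h0.
have up_deg (y : simplex n N) : mdeg (y + U_(i))%MM = N.+1.
  by rewrite mdegD mdeg_simplex mdeg1 addn1.
have down_deg (x : simplex n N.+1) : x i != 0%N -> mdeg (x - U_(i))%MM = N.
  move=> xi; apply: succn_inj; rewrite -[RHS](mdeg_simplex x) -addn1 -(mdeg1 i).
  rewrite -mdegD submK //; apply/mnm_lepP => j; rewrite mnm1E.
  by case: eqP => [<-|]; rewrite ?lt0n.
pose up y := mksimplex (up_deg y).
have up_inj : injective up.
  move=> y z yz; apply: simplex_inj; apply: (@addIm _ U_(i)%MM).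
  by have := congr1 (fun x : simplex n N.+1 => x : 'X_{1..n}) yz.
transitivity (\sum_(x in up @: predT) h x); last first.
  by rewrite big_imset // => y z _ _; apply: up_inj.
rewrite (bigID (fun x : simplex n N.+1 => x \in up @: predT)) /=.
rewrite [X in _ + X]big1 ?addr0 // => x /imsetP xup.
apply: h0; apply/eqP/negPn/negP => xi; apply: xup.
exists (mksimplex (down_deg x xi)); first by rewrite inE.
apply: simplex_inj; rewrite /= submK //; apply/mnm_lepP => j.
by rewrite mnm1E; case: eqP => [<-|]; rewrite ?lt0n.
Qed.

End Simplex.

(** * The kernels F_k *)

Section Poch.
Variable R : realFieldType.
Implicit Type a : R.

Lemma poch0 a : poch a 0 = 1.
Proof. by rewrite /poch big_ord0. Qed.

Lemma pochSr a k : poch a k.+1 = poch a k * (a + k%:R).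
Proof. by rewrite /poch big_ord_recr. Qed.

Lemma pochSl a k : poch a k.+1 = a * poch (a + 1) k.
Proof.
rewrite /poch big_ord_recl addr0; congr (_ * _); apply: eq_bigr => i _.
by rewrite lift0 -addrA nat1r.
Qed.

Lemma poch_ffact m k : poch (- m%:R) k = (-1) ^+ k * (m ^_ k)%:R :> R.
Proof.
elim: k => [|k IH]; first by rewrite poch0 ffactn0 mulr1.
rewrite pochSr IH ffactnSr natrM exprS.
case: (leqP k m) => [km|mk]; first by rewrite natrB //; ring.
by rewrite ffact_small // !(mulr0, mul0r).
Qed.

End Poch.

Section Decrement.
Variables (R : pzRingType) (n : nat).

(** The vector a - e_i, taken without truncation, so entries may become negative in the
    recursion. *)
Definition dec (i : 'I_n) (a : 'I_n -> R) : 'I_n -> R :=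
  fun l => a l - (l == i)%:R.

Lemma sum_dec i a : \sum_l dec i a l = \sum_l a l - 1.
Proof.
rewrite sumrB; congr (_ - _).
by rewrite (bigD1 i) //= eqxx big1 ?addr0 // => l /negPf->.
Qed.

End Decrement.

Section Kernel.
Variables (R : realFieldType) (n : nat) (r : 'I_n -> R).
Implicit Types (a x : 'I_n -> R) (g : 'X_{1..n}).

(** One factor per coordinate, so that changing coordinate i touches a single factor; [ktermE]
    recovers the summand of [calF]. *)
Definition kterm a x g : R :=
  \prod_i (poch (- a i) (g i) * poch (- x i) (g i) / ((g i)`!%:R * r i ^+ g i)).

Definition kF k a x : R := \sum_(g : simplex n k) kterm a x g.

Lemma ktermE a x g :
  kterm a x g = mpoch (fun i => - a i) g * mpoch (fun i => - x i) g
                / ((mfact g)%:R * mpow r g).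
Proof.
by rewrite /mpoch /mpow /mfact natr_prod -!big_split /= -prodf_div.
Qed.

Lemma kterm_sym a x g : kterm a x g = kterm x a g.
Proof. by apply: eq_bigr => i _; rewrite [poch (- a i) _ * _]mulrC. Qed.

Lemma kF_sym k a x : kF k a x = kF k x a.
Proof. by apply: eq_bigr => g _; apply: kterm_sym. Qed.

Lemma eq_kF k a1 a2 x1 x2 : a1 =1 a2 -> x1 =1 x2 -> kF k a1 x1 = kF k a2 x2.
Proof.
by move=> ea ex; do 2!apply: eq_bigr => ? _; rewrite ea ex.
Qed.

(** Splitting off the first or the last factor of (-a_i)_(g_i + 1) gives a_i (1 - a_i)_(g_i) = (a_i
    - g_i) (-a_i)_(g_i). *)
Lemma kterm_dec i a x g :
  a i * kterm (dec i a) x g = (a i - (g i)%:R) * kterm a x g.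
Proof.
rewrite /kterm (bigD1 i) // [X in _ = _ * X](bigD1 i) //= !mulrA.
congr (_ * _); last first.
  by apply: eq_bigr => l li; rewrite /dec (negPf li) subr0.
rewrite /dec eqxx; congr (_ * _ * _).
have -> : - (a i - 1) = - a i + 1 by ring.
apply: oppr_inj; rewrite -mulNr -pochSl pochSr; ring.
Qed.

(** The first factors of (-a_i)_(g_i + 1) and (-x_i)_(g_i + 1) supply a_i x_i, their signs
    cancelling; g_i + 1 corrects the factorial. *)
Lemma kterm_dec2 i a x g : r i != 0 ->
  a i * x i / r i * kterm (dec i a) (dec i x) g
  = ((g + U_(i))%MM i)%:R * kterm a x (g + U_(i))%MM.
Proof.
move=> ri; rewrite /kterm (bigD1 i) // [X in _ = _ * X](bigD1 i) //= !mulrA.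
congr (_ * _); last first.
  apply: eq_bigr => l li; rewrite /dec mnmDE mnm1E (eq_sym i l) (negPf li).
  by rewrite addn0 !subr0.
rewrite /dec eqxx mnmDE mnm1E eqxx addn1 !pochSl.
rewrite (_ : - (a i - 1) = - a i + 1); last by ring.
rewrite (_ : - (x i - 1) = - x i + 1); last by ring.
rewrite factS exprS natrM; field.
by rewrite nat1r !pnatr_eq0 -!lt0n fact_gt0 expf_neq0 ri.
Qed.

Lemma kF_dec k a x :
  \sum_i a i * kF k (dec i a) x = (\sum_i a i - k%:R) * kF k a x.
Proof.
rewrite /kF mulr_sumr; under eq_bigr do rewrite mulr_sumr.
rewrite exchange_big /=; apply: eq_bigr => g _.
by under eq_bigr do rewrite kterm_dec; rewrite -mulr_suml sumrB sum_simplex.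
Qed.

Lemma kF_dec_dec k a x :
  \sum_i \sum_j a i * x j * kF k (dec i a) (dec j x)
  = (\sum_i a i - k%:R) * (\sum_j x j - k%:R) * kF k a x.
Proof.
have step i : \sum_j a i * x j * kF k (dec i a) (dec j x)
    = (\sum_j x j - k%:R) * (a i * kF k (dec i a) x).
  under eq_bigr do rewrite -mulrA kF_sym.
  by rewrite -mulr_sumr kF_dec kF_sym mulrCA.
under eq_bigr do rewrite step; rewrite -mulr_sumr kF_dec; ring.
Qed.

(** After the shift g + e_i, the weight g_i vanishes on the missing indices, so all sums run over
    the same simplex, where the weights add up to k + 1. *)
Lemma kF_dec2 k a x : (forall i, r i != 0) ->
  \sum_i a i * x i / r i * kF k (dec i a) (dec i x) = k.+1%:R * kF k.+1 a x.
Proof.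
move=> r0; rewrite /kF; under eq_bigr do rewrite mulr_sumr.
under eq_bigr => i _ do under eq_bigr => g _ do rewrite kterm_dec2 //.
under eq_bigr => i _.
  rewrite -(@sum_simplexS _ _ _ i
    (fun g : 'X_{1..n} => (g i)%:R * kterm a x g)).
    over.
  by move=> g ->; rewrite mul0r.
rewrite exchange_big mulr_sumr /=; apply: eq_bigr => g _.
by rewrite -mulr_suml sum_simplex.
Qed.

End Kernel.

(** * Contiguity relations for the normalized kernels and for Q_n *)

Section Contiguity.
Variables (R : realFieldType) (n : nat) (r : 'I_n -> R).
Hypothesis r_neq0 : forall i, r i != 0.
Implicit Types (a x : 'I_n -> R).

(** The f_k of the overview, and [kQ] below is its Q_l. Since a and x are real vectors, m and N are
    separate parameters. *)
Definition nF m N k a x : R :=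
  k`!%:R / ((m ^_ k)%:R * (N ^_ k)%:R) * kF r k a x.

Definition kQ l m N a x : R := altsum l (fun k => nF m N k a x).

Lemma eq_kQ l m N a1 a2 x1 x2 : a1 =1 a2 -> x1 =1 x2 ->
  kQ l m N a1 x1 = kQ l m N a2 x2.
Proof.
by move=> ea ex; apply: eq_altsum => k _; rewrite /nF (eq_kF _ _ ea ex).
Qed.

(** The factors m + 1 - k and N + 1 - k from [kF_dec_dec] are absorbed by the normalization, as (p +
    1 - k) (p + 1)^_k = (p + 1) p^_k. *)
Lemma nF_dec m N k a x : (k <= m)%N -> (k <= N)%N ->
    \sum_i a i = m.+1%:R -> \sum_i x i = N.+1%:R ->
  m.+1%:R * N.+1%:R * nF m.+1 N.+1 k a x
  = \sum_i \sum_j a i * x j * nF m N k (dec i a) (dec j x).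
Proof.
move=> km kN sa sx.
have ffactE p : (k <= p)%N ->
    (p.+1%:R - k%:R) * (p.+1 ^_ k)%:R = p.+1%:R * (p ^_ k)%:R :> R.
  by move=> kp; rewrite -natrB 1?leqW // -!natrM -ffactSS ffactnSr mulnC.
have ffact_neq0 p : (k <= p)%N -> (p ^_ k)%:R != 0 :> R.
  by move=> kp; rewrite pnatr_eq0 -lt0n ffact_gt0.
transitivity (k`!%:R / ((m ^_ k)%:R * (N ^_ k)%:R) *
    \sum_i \sum_j a i * x j * kF r k (dec i a) (dec j x)); last first.
  rewrite mulr_sumr; apply: eq_bigr => i _; rewrite mulr_sumr.
  by apply: eq_bigr => j _; rewrite /nF; ring.
rewrite kF_dec_dec sa sx /nF.
have em := ffactE m km; have eN := ffactE N kN.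
have m0 := ffact_neq0 m km; have N0 := ffact_neq0 N kN.
have m1 := ffact_neq0 m.+1 (leqW km); have N1 := ffact_neq0 N.+1 (leqW kN).
have -> : m.+1%:R - k%:R = m.+1%:R * (m ^_ k)%:R / (m.+1 ^_ k)%:R :> R.
  by rewrite -em mulfK.
have -> : N.+1%:R - k%:R = N.+1%:R * (N ^_ k)%:R / (N.+1 ^_ k)%:R :> R.
  by rewrite -eN mulfK.
by field; rewrite m0 N0 m1 N1.
Qed.

Lemma nF_dec2 m N k a x : (k <= m)%N -> (k <= N)%N ->
  m.+1%:R * N.+1%:R * nF m.+1 N.+1 k.+1 a x
  = \sum_i a i * x i / r i * nF m N k (dec i a) (dec i x).
Proof.
move=> km kN.
transitivity (k`!%:R / ((m ^_ k)%:R * (N ^_ k)%:R) *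
    \sum_i a i * x i / r i * kF r k (dec i a) (dec i x)); last first.
  by rewrite mulr_sumr; apply: eq_bigr => i _; rewrite /nF; ring.
have ffact_neq0 p : (k <= p)%N -> (p ^_ k)%:R != 0 :> R.
  by move=> kp; rewrite pnatr_eq0 -lt0n ffact_gt0.
rewrite kF_dec2 // /nF !ffactSS factS !natrM; field.
by rewrite !ffact_neq0 // !nat1r !pnatr_eq0.
Qed.

(** By [altsumS], Q_(l+1) is the transform of f_k - f_(k+1); [nF_dec] expands f_k into the full
    double sum and [nF_dec2] expands f_(k+1) into the diagonal one. *)
Lemma kQ_dec l m N a x : (l <= m)%N -> (m <= N)%N ->
    \sum_i a i = m.+1%:R -> \sum_i x i = N.+1%:R ->
  m.+1%:R * N.+1%:R * kQ l.+1 m.+1 N.+1 a x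
  = \sum_i \sum_j a i * (1 - (i == j)%:R / r i)
                  * (x j * kQ l m N (dec i a) (dec j x)).
Proof.
move=> lm mN sa sx; rewrite /kQ altsumS -altsumB -altsum_mull.
under [RHS]eq_bigr => i _.
  under eq_bigr do rewrite mulrA -altsum_mull.
  rewrite -altsum_sum; over.
rewrite -altsum_sum; apply: eq_altsum => k kl /=.
have km := leq_trans kl lm; have kN := leq_trans km mN.
rewrite mulrBr nF_dec // nF_dec2 // -sumrB; apply: eq_bigr => i _.
rewrite (bigD1 i) // [RHS](bigD1 i) //= eqxx /= addrAC.
congr (_ + _); first by ring.
apply: eq_bigr => j ji; rewrite eq_sym (negPf ji) /=; ring.
Qed.

End Contiguity.

(** * Orthogonality *)

Section InnerProduct.
Variables (R : realFieldType) (d : nat) (rho : 'I_d -> R).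
Hypothesis rho_gt0 : forall i, 0 < rho i.
Hypothesis rho_lt1 : \sum_i rho i < 1.
Notation r := (brho rho).

Lemma brho_gt0 i : 0 < r i.
Proof. by rewrite /brho; case: unliftP => [j|] _ //; rewrite subr_gt0. Qed.

Lemma sum_brho : \sum_i r i = 1.
Proof.
rewrite (bigD1_ord ord_max) //= {1}/brho unlift_none.
under eq_bigr do rewrite /brho liftK.
by rewrite subrK.
Qed.

Lemma kip_eq0 N (u : {ffun simplex d.+1 N -> R^o}) : kip rho u u = 0 -> u = 0.
Proof.
move=> u0; apply/ffunP=> x; rewrite ffunE.
have w_gt0 (y : simplex d.+1 N) : 0 < mpow r y / (mfact y)%:R.
  rewrite divr_gt0 ?ltr0n ?prodn_gt0 //; last by move=> i; rewrite fact_gt0.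
  by apply: prodr_gt0 => i _; rewrite exprn_gt0 ?brho_gt0.
move/eqP: u0; rewrite mulf_eq0 pnatr_eq0 -leqn0 leqNgt fact_gt0 /=.
rewrite psumr_eq0 => [/allP/(_ x (mem_index_enum _))|y _].
  by rewrite mulf_eq0 (gt_eqF (w_gt0 x)) orbF mulf_eq0 orbb => /eqP.
exact: mulr_ge0 (@sqr_ge0 R (u y)) (ltW (w_gt0 y)).
Qed.

(** The difference of the two candidates lies in W and is orthogonal to W, hence to itself, and the
    form is definite. *)
Lemma orthproj_unique N (W : {vspace {ffun simplex d.+1 N -> R^o}}) f p :
  p \in W -> f - p \in korth rho W -> orthproj rho W f = p.
Proof.
move=> pW fp; have [qW fq] := orthprojP rho_gt0 rho_lt1 W f.
set q := orthproj rho W f in qW fq *.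
apply/eqP; rewrite -subr_eq0; apply/eqP/kip_eq0.
have qpW : q - p \in W by rewrite rpredB.
have -> : kip rho (q - p) (q - p) = kip rho ((f - p) - (f - q)) (q - p).
  by rewrite opprB [f - p]addrC addrACA subrr addr0 [- p + q]addrC.
by rewrite linearBl /= fq // (mem_korthP rho W _ fp) // subrr.
Qed.

(* The adjoint of f |-> x_j f(x - e_j), where f and its image live on the
   simplices of sizes N and N + 1. *)
Lemma kip_shift N j (f g : 'X_{1..d.+1} -> R^o) :
  kip rho [ffun x : simplex d.+1 N.+1 => ((x j)%:R * f (x - U_(j))%MM : R^o)]
          [ffun x : simplex d.+1 N.+1 => g x]
  = N.+1%:R * r j * kip rho [ffun y : simplex d.+1 N => f y]
                            [ffun y : simplex d.+1 N => g (y + U_(j))%MM].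
Proof.
rewrite /kip; under eq_bigr do rewrite !ffunE.
under [in RHS]eq_bigr do rewrite !ffunE.
(* The factor x_j allows the substitution x = y + e_j. The weight then changes by r_j / (y_j + 1),
   whose denominator cancels x_j; N + 1 comes from (N + 1)!. *)
rewrite (@sum_simplexS _ _ _ j (fun x : 'X_{1..d.+1} =>
  (x j)%:R * f (x - U_(j))%MM * g x * (mpow r x / (mfact x)%:R))); last first.
  by move=> x ->; rewrite !mul0r.
rewrite factS natrM -!mulrA; congr (_ * _).
rewrite [RHS]mulrCA [r j * _]mulr_sumr.
congr (_ * _); apply: eq_bigr => y _; rewrite addmK.
have -> : mpow r (y + U_(j))%MM = r j * mpow r y.
  rewrite /mpow (bigD1 j) // [in RHS](bigD1 j) //= mnmDE mnm1E eqxx addn1.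
  rewrite exprS -mulrA; congr (_ * (_ * _)); apply: eq_bigr => l lj.
  by rewrite mnmDE mnm1E eq_sym (negPf lj) addn0.
have -> : mfact (y + U_(j))%MM = ((y j).+1 * mfact y)%N.
  rewrite /mfact (bigD1 j) // [in RHS](bigD1 j) //= mnmDE mnm1E eqxx addn1.
  rewrite factS -mulnA; congr (_ * (_ * _))%N; apply: eq_bigr => l lj.
  by rewrite mnmDE mnm1E eq_sym (negPf lj) addn0.
rewrite mnmDE mnm1E eqxx addn1 natrM.
have y0 : (y j).+1%:R != 0 :> R by rewrite pnatr_eq0.
have m0 : (mfact y)%:R != 0 :> R.
  by rewrite pnatr_eq0 -lt0n prodn_gt0 // => i; rewrite fact_gt0.
have cancel (u v F G q w : R) : u != 0 -> v != 0 ->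
  u * F * G * (q * w / (u * v)) = q * (F * G * (w / v)).
  by move=> u0 v0; field; rewrite v0 u0.
exact: cancel.
Qed.

End InnerProduct.

(** * Degrees of polynomial functions on the simplex *)

Section Polys.
Variables (R : realFieldType) (d N : nat).

Lemma msizeM_leq j k (p q : {mpoly R[d]}) :
  (msize p <= j.+1)%N -> (msize q <= k)%N -> (msize (p * q) <= j + k)%N.
Proof.
move=> pj qk; have [->|p0] := eqVneq p 0; first by rewrite mul0r msize0.
have [->|q0] := eqVneq q 0; first by rewrite mulr0 msize0.
by rewrite msizeM // -subn1 leq_subLR addnA add1n leq_add.
Qed.

(** Differences lower the degree: [msize] is the degree plus one, so the bound drops from k to k -
    1. Linearity reduces this to monomials. *)
Lemma msize_shift (e : 'I_d -> R) k (p : {mpoly R[d]}) : (msize p <= k.+1)%N ->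
  exists2 q : {mpoly R[d]}, (msize q <= k)%N &
    forall v, p.@[fun i => v i + e i] - p.@[v] = q.@[v].
Proof.
have mon (m : 'X_{1..d}) : (mdeg m <= k)%N -> exists2 q : {mpoly R[d]},
    (msize q <= k)%N &
    forall v, 'X_[m].@[fun i => v i + e i] - 'X_[m].@[v] = q.@[v].
  elim: k m => [|k IH] m mk.
    exists 0; first by rewrite msize0.
    move=> v; move: mk; rewrite leqn0 mdeg_eq0 => /eqP->.
    by rewrite mpolyX0 !meval1 meval0 subrr.
  have [m0|/existsP[i mi]] := boolP [forall i, m i == 0%N]; last first.
    have mE : m = (U_(i) + (m - U_(i)))%MM.
      rewrite addmC submK //; apply/mnm_lepP => j; rewrite mnm1E.
      by case: eqP => [<-|]; rewrite ?lt0n.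
    have m'k : (mdeg (m - U_(i))%MM <= k)%N.
      by move: mk; rewrite {1}mE mdegD mdeg1 add1n ltnS.
    have [q qk qE] := IH _ m'k.
    (* With M the monomial divided by its variable i and q its difference, (v_i + e_i) M(v + e) -
       v_i M(v) = v_i q(v) + e_i (q(v) + M(v)). *)
    exists ('X_i * q + e i *: (q + 'X_[m - U_(i)])).
      rewrite (leq_trans (msizeD_le _ _)) // geq_max; apply/andP; split.
        by rewrite -add1n msizeM_leq // msizeX mdeg1.
      rewrite (leq_trans (msizeZ_le _ _)) // (leq_trans (msizeD_le _ _)) //.
      by rewrite geq_max msizeX ltnS m'k leqW.
    move=> v; rewrite {1 2}mE mpolyXD !mevalM mevalD mevalM mevalZ mevalD.
    rewrite !mevalXU -qE; ring.
  exists 0; first by rewrite msize0.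
  have -> : m = 0%MM by apply/mnmP => i; rewrite mnm0E; apply/eqP/(forallP m0).
  by move=> v; rewrite mpolyX0 !meval1 meval0 subrr.
move=> pk; rewrite (mpolyE p).
have: {in msupp p, forall m, (mdeg m <= k)%N}.
  by move=> m /msize_mdeg_lt mp; rewrite -ltnS (leq_trans mp).
elim: (msupp p) => [|m s IH] h.
  by exists 0; rewrite ?msize0 // => v; rewrite big_nil !meval0 subrr.
have [m' sm'|q qk qE] := IH; first by apply: h; rewrite in_cons sm' orbT.
have [q' q'k q'E] := mon m (h m (mem_head _ _)).
exists (p@_m *: q' + q) => [|v].
  rewrite (leq_trans (msizeD_le _ _)) // geq_max qk andbT.
  exact: leq_trans (msizeZ_le _ _) _.
rewrite big_cons !mevalD !mevalZ -q'E -qE; ring.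
Qed.

Lemma msize_prod_le (I : Type) (s : seq I) (F : I -> {mpoly R[d]})
    (e : I -> nat) :
  (forall i, (msize (F i) <= (e i).+1)%N) ->
  (msize (\prod_(i <- s) F i) <= (\sum_(i <- s) e i).+1)%N.
Proof.
move=> Fe; apply: (big_ind2 (fun p k => msize p <= k.+1)%N) => //
  [|p j q k pj qk].
  by rewrite msize1.
by rewrite -addnS msizeM_leq.
Qed.

Lemma polys_sub k l : (k <= l)%N -> (polys R d N k <= polys R d N l)%VS.
Proof.
move=> kl; apply/subvP => f /polysP[p pk ->]; apply/polysP.
by exists p; rewrite // (leq_trans pk).
Qed.

(** The last coordinate is N minus the others on the simplex, so it too has degree at most 1 in the
    first d. *)
Lemma coord_poly (i : 'I_d.+1) : exists2 p : {mpoly R[d]}, (msize p <= 2)%N &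
  forall x : simplex d.+1 N, p.@[fun l => pt R x (lift ord_max l)] = (x i)%:R.
Proof.
case: (unliftP ord_max i) => [j ->|->].
  by exists 'X_j; rewrite ?msizeX ?mdeg1 // => x; rewrite mevalXU.
exists (N%:R%:MP - \sum_j 'X_j) => [|x].
  rewrite (leq_trans (msizeD_le _ _)) // geq_max msizeN; apply/andP; split.
    by rewrite msizeC; case: (_ != _).
  rewrite (leq_trans (msize_sum _ _ _)) //; apply/bigmax_leqP => j _.
  by rewrite msizeX mdeg1.
rewrite mevalB mevalC (big_morph _ (mevalD _) (meval0 _)) /=.
under eq_bigr do rewrite mevalXU.
apply/eqP; rewrite subr_eq -(sum_simplex R x) (bigD1_ord ord_max) //=.
Qed.

Lemma mpoch_polys (g : 'X_{1..d.+1}) k : (mdeg g <= k)%N ->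
  [ffun x : simplex d.+1 N => (mpoch (fun i => - pt R x i) g : R^o)]
    \in polys R d N k.+1.
Proof.
move=> gk; apply/polysP.
have [P Pm PE] := fin_all_exists2 coord_poly.
exists (\prod_i \prod_(j < g i) (- P i + j%:R%:MP)) => [|].
  rewrite (leq_trans (msize_prod_le (e := g) _ _)) // ?ltnS -?mdegE //.
  move=> i.
  rewrite (leq_trans (msize_prod_le (e := fun _ => 1%N) _ _)) // => [j|].
    rewrite (leq_trans (msizeD_le _ _)) // geq_max msizeN Pm.
    by rewrite msizeC; case: (_ != _).
  by rewrite sum1_card card_ord.
apply/ffunP => x; rewrite !ffunE (big_morph _ (mevalM _) (meval1 _)).
apply: eq_bigr => i _.
rewrite (big_morph _ (mevalM _) (meval1 _)); apply: eq_bigr => j _.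
by rewrite /= mevalD mevalN mevalC PE.
Qed.

Lemma kF_polys (r a : 'I_d.+1 -> R) k :
  [ffun x : simplex d.+1 N => (kF r k a (pt R x) : R^o)] \in polys R d N k.+1.
Proof.
rewrite (_ : [ffun _ => _] = \sum_(g : simplex d.+1 k)
    (mpoch (fun i => - a i) g / ((mfact g)%:R * mpow r g)) *:
      [ffun x : simplex d.+1 N => (mpoch (fun i => - pt R x i) g : R^o)]).
  by apply: memv_suml => g _; rewrite rpredZ // mpoch_polys ?mdeg_simplex.
apply/ffunP => x; rewrite sum_ffunE ffunE; apply: eq_bigr => g _.
by rewrite ktermE !ffunE mulrAC.
Qed.

Lemma kQ_polys (r a : 'I_d.+1 -> R) n m M :
  [ffun x : simplex d.+1 N => (kQ r n m M a (pt R x) : R^o)]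
    \in polys R d N n.+1.
Proof.
rewrite (_ : [ffun _ => _] = \sum_(k < n.+1)
    ((-1) ^+ k * 'C(n, k)%:R * (k`!%:R / ((m ^_ k)%:R * (M ^_ k)%:R))) *:
      [ffun x : simplex d.+1 N => (kF r k a (pt R x) : R^o)]).
  apply: memv_suml => k _; rewrite rpredZ //.
  exact: (subvP (polys_sub (ltn_ord k))) (kF_polys _ _ _).
apply/ffunP => x; rewrite sum_ffunE ffunE; apply: eq_bigr => k _.
by rewrite !ffunE; exact: mulrA.
Qed.


End Polys.

(** * Orthogonality of Q_n to lower degrees *)

Section Orthogonality.
Variables (R : realFieldType) (d : nat) (rho : 'I_d -> R).
Hypothesis rho_gt0 : forall i, 0 < rho i.
Hypothesis rho_lt1 : \sum_i rho i < 1.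
Notation r := (brho rho).

(** Defined on multi-indices of every size, so that p can be evaluated at y + e_j, which lies on the
    next simplex. *)
Definition peval (p : {mpoly R[d]}) (x : 'X_{1..d.+1}) : R^o :=
  p.@[fun l => pt R x (lift ord_max l)].

Lemma polys_shiftB N k (p : {mpoly R[d]}) (i j : 'I_d.+1) :
    (msize p <= k.+1)%N ->
  [ffun y : simplex d.+1 N => peval p (y + U_(j))%MM - peval p (y + U_(i))%MM]
    \in polys R d N k.
Proof.
move=> pk; set G := peval p.
have shift l : [ffun y : simplex d.+1 N => G (y + U_(l))%MM - G y]
    \in polys R d N k.
  have [q qk qE] := msize_shift (fun h => (l == lift ord_max h)%:R : R) pk.
  apply/polysP; exists q => //; apply/ffunP => y; rewrite !ffunE -qE.
  congr (_ - _); rewrite /G /peval; apply: meval_eq => h.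
  by rewrite /pt mnmDE mnm1E natrD.
rewrite (_ : [ffun _ => _] = [ffun y : simplex d.+1 N => G (y + U_(j))%MM - G y]
    - [ffun y : simplex d.+1 N => G (y + U_(i))%MM - G y]) ?rpredB //.
by apply/ffunP => y; rewrite !ffunE opprB addrA subrK.
Qed.

(** Induction on l through [kQ_dec] and the adjoint [kip_shift]. The vector a is real because a -
    e_i need not be a multi-index. *)
Lemma kQ_orth l m N a (g : {ffun simplex d.+1 N -> R^o}) :
    (l <= m)%N -> (m <= N)%N -> \sum_i a i = m%:R -> g \in polys R d N l ->
  kip rho [ffun x : simplex d.+1 N => (kQ r l m N a (pt R x) : R^o)] g = 0.
Proof.
have r0 i : r i != 0 by rewrite gt_eqF ?brho_gt0.
elim: l m N a g => [|l IH] m N a g lm mN sa /polysP[p pl ->] {g}.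
  move: pl; rewrite leqn0 msize_poly_eq0 => /eqP->.
  rewrite (_ : polyfun N (0 : {mpoly R[d]}) = 0) ?linear0r //.
  by apply/ffunP => x; rewrite !ffunE meval0.
case: m N lm mN sa => [|m] [|N] // lm mN sa.
pose G := peval p.
pose K i (y : 'X_{1..d.+1}) : R^o := kQ r l m N (dec i a) (pt R y).
pose S i j := kip rho [ffun y : simplex d.+1 N => K i y]
   [ffun y : simplex d.+1 N => G (y + U_(j))%MM].
(* The difference pairs K i with G(. + e_j) - G(. + e_i), of degree below l, so the induction
   hypothesis applies. *)
have S0 i j : S i j = S i i.
  apply/eqP; rewrite -subr_eq0 -linearBr /= -[X in X == 0]/(kip _ _ _).
  rewrite (_ : _ - _ = [ffun y : simplex d.+1 N =>
    G (y + U_(j))%MM - G (y + U_(i))%MM]); last first.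
    by apply/ffunP => y; rewrite !ffunE.
  rewrite /K IH // ?polys_shiftB // sum_dec sa -natr1; ring.
have KE (x : simplex d.+1 N.+1) :
    m.+1%:R * N.+1%:R * kQ r l.+1 m.+1 N.+1 a (pt R x)
    = \sum_i \sum_j a i * (1 - (i == j)%:R / r i)
                    * ((x j)%:R * K i (x - U_(j))%MM).
  rewrite kQ_dec ?sum_simplex //.
  apply: eq_bigr => i _; apply: eq_bigr => j _; congr (_ * _).
  rewrite [pt R x j]/pt.
  (* Truncated subtraction of e_j differs from [dec] only when x_j = 0, where the factor x_j
     vanishes. *)
  have [->|xj] := eqVneq (x j) 0%N; first by rewrite !mul0r.
  congr (_ * _); apply: eq_kQ => // h.
  rewrite /pt /dec mnmBE mnm1E natrB; first by rewrite eq_sym.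
  by case: eqP => [<-|]; rewrite ?lt0n.
have c0 : m.+1%:R * N.+1%:R != 0 :> R by rewrite mulf_neq0 // pnatr_eq0.
apply: (mulfI c0); rewrite mulr0.
transitivity (\sum_i \sum_j
    a i * (1 - (i == j)%:R / r i) * (N.+1%:R * r j * S i j)).
  rewrite -(linearZl_LR (kip (N := N.+1) rho)).
  rewrite (_ : _ *: _ = \sum_i \sum_j (a i * (1 - (i == j)%:R / r i)) *:
    [ffun x : simplex d.+1 N.+1 => ((x j)%:R * K i (x - U_(j))%MM : R^o)]).
    rewrite linear_sumlz; apply: eq_bigr => i _.
    rewrite linear_sumlz; apply: eq_bigr => j _.
    by rewrite linearZl_LR /=; congr (_ * _); apply: kip_shift.
  apply/ffunP => x; rewrite !ffunE [LHS]KE sum_ffunE; apply: eq_bigr => i _.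
  by rewrite sum_ffunE; apply: eq_bigr => j _; rewrite !ffunE.
apply: big1 => i _.
(* As S i j is independent of j, only the sum of r_j - [i = j] remains, and it is zero because the
   r_j add up to 1. *)
transitivity (a i * N.+1%:R * S i i * \sum_j (r j - (i == j)%:R)).
  rewrite mulr_sumr; apply: eq_bigr => j _; rewrite S0.
  have [<-|ij] := eqVneq i j; last by rewrite /=; ring.
  by rewrite /=; field.
rewrite sumrB sum_brho // (bigD1 i) //= eqxx big1 ?addr0 ?subrr ?mulr0 //.
by move=> j /negPf; rewrite eq_sym => ->.
Qed.
End Orthogonality.

(** * The projections of m_alpha and the explicit formula *)

(** Only g = alpha contributes: any other g of the same size exceeds alpha at some i, where
    (-alpha_i)_(g_i) = 0. *)
Lemma kF_top (R : realFieldType) n m (r x : 'I_n -> R) (alpha : simplex n m) :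
  kF r m (pt R alpha) x
  = (-1) ^+ m * mpoch (fun i => - x i) alpha / mpow r alpha.
Proof.
rewrite /kF (bigD1 alpha) //= big1 ?addr0 => [|g ga].
  have -> : (-1) ^+ m = \prod_i (-1) ^+ alpha i :> R.
    by rewrite prodrXr -mdegE mdeg_simplex.
  rewrite /kterm /mpoch /mpow -big_split -prodf_div; apply: eq_bigr => i _ /=.
  rewrite poch_ffact ffactnn invfM mulrA; congr (_ * _).
  rewrite mulrAC mulfK //.
  by rewrite pnatr_eq0 -lt0n fact_gt0.
have [/forallP ge|/forallPn[i]] := boolP [forall i, g i <= alpha i]%N.
  case/eqP: ga; apply: simplex_inj; apply/mnmP => i.
  have /leqif_sum :
      forall i, true -> (g i <= alpha i ?= iff (g i == alpha i))%N.
    by move=> j _; split.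
  rewrite -!mdegE !mdeg_simplex => /leqif_refl /forallP.
  by move/(_ i)/eqP.
rewrite -ltnNge => ag; rewrite /kterm (bigD1 i) //= poch_ffact ffact_small //.
by rewrite !(mulr0, mul0r).
Qed.

Lemma calFE (R : realFieldType) d (rho : 'I_d -> R) k a x :
  calF rho k a x = kF (brho rho) k a x.
Proof.
rewrite /calF; case: eqP => [->|_]; last first.
  by apply: eq_bigr => g _; rewrite ktermE.
pose z : simplex d.+1 0 := mksimplex (@mdeg0 d.+1).
rewrite /kF (bigD1 z) //= big1 => [|g /eqP[]].
  rewrite addr0 /kterm big1 // => i _.
  by rewrite mnm0E !poch0 expr0 fact0 mulr1n !mulr1 divr1.
by apply: simplex_inj; apply/eqP; rewrite -mdeg_eq0 mdeg_simplex.
Qed.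

Lemma mpow_brho_neq0 (R : realFieldType) d (rho : 'I_d -> R) g :
  (forall i, 0 < rho i) -> \sum_i rho i < 1 -> mpow (brho rho) g != 0.
Proof.
by move=> h0 h1; apply/prodf_neq0 => i _; rewrite expf_neq0 // gt_eqF ?brho_gt0.
Qed.

Lemma orthproj_mfall (R : realFieldType) (d n m N : nat) (rho : 'I_d -> R)
    (rho_gt0 : forall i, 0 < rho i) (rho_lt1 : \sum_i rho i < 1)
    (alpha : simplex d.+1 m) : (n <= m)%N -> (m <= N)%N ->
  orthproj rho (calV rho N n) (mfall R N alpha) =
    (mpow (brho rho) alpha * ((-1) ^+ n * 'C(m, n)%:R * (N ^_ m)%:R)) *:
    [ffun x : simplex d.+1 N =>
      (kQ (brho rho) n m N (pt R alpha) (pt R x) : R^o)].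
Proof.
move=> nm mN; set r := brho rho.
pose q j := [ffun x : simplex d.+1 N =>
  (kQ r j m N (pt R alpha) (pt R x) : R^o)].
pose c j := mpow r alpha * ((-1) ^+ j * 'C(m, j)%:R * (N ^_ m)%:R).
have q_orth j : (j <= m)%N -> q j \in korth rho (polys R d N j).
  move=> jm; apply/mem_korthP => g gj.
  by apply: kQ_orth => //; rewrite sum_simplex.
have fE : mfall R N alpha = \sum_(j < m.+1) c j *: q j.
  apply/ffunP => x; rewrite sum_ffunE ffunE.
  transitivity (mpow r alpha * (N ^_ m)%:R *
      nF r m N m (pt R alpha) (pt R x)); last first.
    (* Binomial inversion expands f_m in the Q_j. *)
    rewrite -(altsumK m (fun k => nF r m N k (pt R alpha) (pt R x))).
    rewrite -altsum_mull; apply: eq_bigr => j _.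
    by rewrite !ffunE -[RHS]/(_ * _) /c /kQ; ring.
  rewrite /nF kF_top mdeg_simplex ffactnn; field.
  by rewrite mpow_brho_neq0 // !pnatr_eq0 -!lt0n ffact_gt0 mN fact_gt0.
apply: orthproj_unique => //.
  rewrite rpredZ //; apply/memv_capP; split; first exact: kQ_polys.
  exact: q_orth.
rewrite -/(q n) -/(c n) fE (bigD1 (Ordinal (nm : (n < m.+1)%N))) //=.
rewrite addrAC subrr add0r.
apply: memv_suml => j jn; rewrite rpredZ //.
apply/mem_korthP => v /memv_capP[vn /mem_korthP vo].
(* For j < n, q_j has degree below n, to which v is orthogonal; for j > n, q_j is orthogonal to
   degrees below j, which include v. *)
have [jlt|nlt] := ltnP j n.
  rewrite kip_sym /= expr0 mul1r; apply: vo.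
  exact: (subvP (polys_sub R d N jlt)) (kQ_polys _ _ _ _ _ _).
have nj : (n < j)%N by rewrite ltn_neqAle nlt andbT eq_sym; exact: jn.
apply: (mem_korthP rho _ _ (q_orth j _)); first by rewrite -ltnS.
exact: (subvP (polys_sub R d N nj)).
Qed.

Unset Implicit Arguments.

Theorem proposition4p9 (R : realFieldType) (d n m N : nat) (rho : 'I_d -> R)
    (hd : (1 <= d)%N) (hnm : (n <= m)%N) (hmN : (m <= N)%N)
    (hrho : forall i : 'I_d, 0 < rho i < 1) (hsum : \sum_(i < d) rho i < 1)
    (alpha : simplex d.+1 m) (x : simplex d.+1 N) :
  sfL rho N alpha n x =
    (-1) ^+ m * poch (- N%:R) m * poch (- m%:R) n / n`!%:R
    * \sum_(0 <= k < n.+1)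
        poch (- n%:R) k / (poch (- m%:R) k * poch (- N%:R) k)
        * calF rho k (pt R alpha) (pt R x).
Proof.
have rho_gt0 i : 0 < rho i by case/andP: (hrho i).
have r0 := mpow_brho_neq0 alpha rho_gt0 hsum.
rewrite /sfL orthproj_mfall // scalerA mulKf // !ffunE -[LHS]/(_ * _).
(* The sign of (-N)_m cancels (-1)^m, and (-m)_n / n! = (-1)^n C(m,n). *)
rewrite !poch_ffact signrMK; congr (_ * _).
  rewrite -(bin_ffact m n) natrM; field.
  by rewrite pnatr_eq0 -lt0n fact_gt0.
rewrite big_mkord /kQ /altsum; apply: eq_bigr => k _.
rewrite calFE /nF mulrA; congr (_ * _).
(* The signs of (-m)_k and (-N)_k cancel; (-n)_k = (-1)^k C(n,k) k! supplies the coefficient in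
   Q_n. *)
rewrite !poch_ffact [in RHS]mulrACA -expr2 sqrr_sign mul1r.
by rewrite -(bin_ffact n k) natrM !mulrA.
Qed.
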